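(* There are absolute constants $\kappa,K>0$ such that for every $N\ge1$ and every concept class $\mathcal C\subseteq\{0,1\}^N$ with $|\mathcal C|\ge 2$, $$\mathsf Q(\mathcal C)\ge \kappa\sqrt{\mathrm{fETD}(\mathcal C)},\qquad \mathsf R(\mathcal C)\le K\,\frac{\mathrm{fETD}(\mathcal C)}{\log(\mathrm{fETD}(\mathcal C)+1)}\,\log|\mathcal C| .$$ Equivalently (up to the values of the absolute constants), $$\mathsf Q(\mathcal C)\ge \kappa\sqrt{\frac{1}{\mathrm f\gamma(\mathcal C)}},\qquad \mathsf R(\mathcal C)\le K\,\frac{1}{\mathrm f\gamma(\mathcal C)\,\log(1/\mathrm f\gamma(\mathcal C)+1)}\,\log|\mathcal C| .$$
   Context: A concept class is a set $\mathcal C\subseteq\{0,1\}^N$. In exact learning with membership queries, an unknown target $c^*\in\mathcal C$ is accessed by queries and the learner must output $c^*$. A classical query at $i\in[N]$ returns $c^*_i$; queries may be adaptive. $\mathsf R(\mathcal C)$ is the minimum worst-case number of queries of a randomized learner that, for every $c^*\in\mathcal C$, outputs $c^*$ with probability at least $2/3$. $\mathsf Q(\mathcal C)$ is the bounded-error quantum query complexity: the minimum number of applications of the unitary $|i,b\rangle\mapsto|i,b\oplus c^*_i\rangle$ (interleaved with arbitrary target-independent unitaries, followed by a measurement) needed by a quantum algorithm that outputs $c^*$ with probability at least $2/3$ for every $c^*\in\mathcal C$. Logarithms are base 2. For $i\in[N]$ and $b\in\{0,1\}$ put $\mathcal C_{i,b}=\{c\in\mathcal C: c_i=b\}$. The fractional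 splitting parameter is $$\mathrm f\gamma(\mathcal C)=\min_{\mu}\ \max_{i\in[N]}\ \min\{\mu(\mathcal C_{i,0}),\mu(\mathcal C_{i,1})\},$$ the minimum being over probability distributions $\mu$ on $\mathcal C$ with $\max_{c\in\mathcal C}\mu(c)\le 1/2$. For $h\in\{0,1\}^N$, $$\mathrm{fETD}(\mathcal C,h)=\min_{c^*\in\mathcal C,\ w_1,\dots,w_N\ge0}\Big\{\sum_{i=1}^N w_i:\ \sum_{i:c_i\ne h_i}w_i\ge1\ \text{for every } c\in\mathcal C\setminus\{c^*\}\Big\},$$ with $w_1,\dots,w_N$ real, and the fractional extended teaching dimension is $\mathrm{fETD}(\mathcal C)=\max_{h\in\{0,1\}^N}\mathrm{fETD}(\mathcal C,h)$. *)

(* Defs.v *)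
From HB Require Import structures.
From mathcomp Require Import all_boot all_order all_algebra.
From mathcomp Require Import complex.
From mathcomp Require Import all_classical all_reals all_analysis.

Set Implicit Arguments.
Unset Strict Implicit.
Unset Printing Implicit Defensive.

Import Order.TTheory GRing.Theory Num.Theory.

Local Open Scope ring_scope.
Local Open Scope classical_set_scope.
Local Open Scope sesquilinear_scope.

Definition log2 {R : realType} (x : R) : R := ln x / ln 2.

Definition concept (N : nat) := {ffun 'I_N -> bool}.

(* The default 0 is used only if no natural number satisfies [P]. *)
Definition minimum_nat (P : nat -> Prop) : nat :=
  xget 0%N [set n | P n /\ forall m, P m -> (n <= m)%N].

Lemma minimum_natP (P : nat -> Prop) :
  (exists n, P n) ->
  P (minimum_nat P) /\ forall m, P m -> (minimum_nat P <= m)%N.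
Proof.
case=> n Pn; rewrite /minimum_nat.
have exP : exists n, `[< P n >] by exists n; apply/asboolP.
case: (ex_minnP exP) => m /asboolP Pm minm.
apply: (@xgetPex _ 0%N [set n | P n /\ forall m, P m -> (n <= m)%N]).
by exists m; split=> // k Pk; apply: minm; apply/asboolP.
Qed.

Inductive dtree (N : nat) : Type :=
| Output of concept N
| Query of 'I_N & (bool -> dtree N).

Fixpoint dtree_run N (t : dtree N) (c : concept N) : concept N :=
  match t with
  | Output h => h
  | Query i next => dtree_run (next (c i)) c
  end.

Fixpoint dtree_cost N (t : dtree N) (c : concept N) : nat :=
  match t with
  | Output _ => 0
  | Query i next => (dtree_cost (next (c i)) c).+1
  end.

Record rlearner (R : realType) (N : nat) := RLearner {
  rl_size : nat;
  rl_prob : 'I_rl_size -> R;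
  rl_tree : 'I_rl_size -> dtree N;
  rl_prob_ge0 : forall k, 0 <= rl_prob k;
  rl_prob_sum : \sum_(k < rl_size) rl_prob k = 1 }.

Arguments rl_prob {R N} r k.
Arguments rl_tree {R N} r k.

Definition rlearner_success (R : realType) N (A : rlearner R N)
    (c : concept N) : R :=
  \sum_(k < rl_size A | dtree_run (rl_tree A k) c == c) rl_prob A k.

Definition rlearns (R : realType) N (C : {set concept N}) (T : nat)
    (A : rlearner R N) : Prop :=
  forall c, c \in C ->
    (forall k, (dtree_cost (rl_tree A k) c <= T)%N) /\
    2 / 3 <= rlearner_success A c.

Definition RQ (R : realType) N (C : {set concept N}) : nat :=
  minimum_nat (fun T => exists A : rlearner R N, rlearns C T A).

(* Labels (i, b, w) of the computational basis: query index, answer bit, and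
   an arbitrary finite workspace.  Matrices are indexed by ordinals, through
   [enum_rank] and [enum_val]. *)
Definition qbasis (N : nat) (W : finType) : finType := ('I_N * bool * W)%type.

Definition ket (R : realType) (X : finType) (x : X) : 'cV[R[i]]_#|X| :=
  delta_mx (enum_rank x) 0.

Definition basis_map_mx (R : realType) (X : finType) (f : X -> X) :
    'M[R[i]]_#|X| :=
  \matrix_(a, b) (enum_val a == f (enum_val b))%:R.

Definition query_basis N (W : finType) (c : concept N) (x : qbasis N W) :
    qbasis N W :=
  (x.1.1, x.1.2 (+) c x.1.1, x.2).

Definition oracle (R : realType) N (W : finType) (c : concept N) :
    'M[R[i]]_#|qbasis N W| :=
  basis_map_mx R (@query_basis N W c).

(* [ql_meas h] is the measurement operator of the outcome "output h". *)
Record qlearner (R : realType) (N : nat) := QLearner {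
  ql_work : finType;
  ql_init : qbasis N ql_work;
  ql_unitary : nat -> 'M[R[i]]_#|qbasis N ql_work|;
  ql_meas : concept N -> 'M[R[i]]_#|qbasis N ql_work|;
  ql_unitaryP : forall t, ql_unitary t \is unitarymx;
  ql_measP : \sum_h (ql_meas h)^t* *m ql_meas h = 1%:M }.

Fixpoint qlearner_state (R : realType) N (A : qlearner R N) (c : concept N)
    (T : nat) : 'cV[R[i]]_#|qbasis N (ql_work A)| :=
  match T with
  | 0 => ql_unitary A 0 *m ket R (ql_init A)
  | t.+1 => ql_unitary A t.+1 *m (oracle R (ql_work A) c *m qlearner_state A c t)
  end.

(* The probability is computed in R[i], where [x <= y] entails that [y - x] is
   real. *)
Definition qlearner_success (R : realType) N (A : qlearner R N) (T : nat)
    (c : concept N) : R[i] :=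
  \sum_a `| (ql_meas A c *m qlearner_state A c T) a 0 | ^+ 2.

Definition qlearns (R : realType) N (C : {set concept N}) (T : nat)
    (A : qlearner R N) : Prop :=
  forall c, c \in C -> 2 / 3 <= qlearner_success A T c.

Definition QQ (R : realType) N (C : {set concept N}) : nat :=
  minimum_nat (fun T => exists A : qlearner R N, qlearns C T A).

Definition restrict N (C : {set concept N}) (i : 'I_N) (b : bool) :
    {set concept N} :=
  [set c in C | c i == b]%SET.

Definition is_dist (R : realType) N (C : {set concept N})
    (mu : concept N -> R) : Prop :=
  (forall c, c \in C -> 0 <= mu c) /\ \sum_(c in C) mu c = 1.

Definition mass (R : realType) N (mu : concept N -> R) (A : {set concept N}) :
    R := \sum_(c in A) mu c.

Definition split_value (R : realType) N (C : {set concept N})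
    (mu : concept N -> R) : R :=
  \big[Num.max/0]_(i < N)
    Num.min (mass mu (restrict C i false)) (mass mu (restrict C i true)).

(* For |C| >= 2 this is an infimum over a nonempty compact set, hence a minimum;
   [inf] would be 0 on the empty set. *)
Definition fgamma (R : realType) N (C : {set concept N}) : R :=
  inf [set split_value C mu | mu in
        [set mu : concept N -> R |
          is_dist C mu /\ forall c, c \in C -> mu c <= 1 / 2]].

Definition fETD_feasible (R : realType) N (C : {set concept N})
    (h cstar : concept N) (w : 'I_N -> R) : Prop :=
  [/\ cstar \in C, forall i, 0 <= w i
    & forall c, c \in C -> c != cstar -> 1 <= \sum_(i < N | c i != h i) w i].

(* The optimum of a linear program for each of the finitely many choices of
   [cstar].  The constant weight 1 is feasible for some [cstar] if C is
   nonempty, so the infimum is a minimum. *)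
Definition fETD_at (R : realType) N (C : {set concept N}) (h : concept N) : R :=
  inf [set s | exists cstar (w : 'I_N -> R),
         fETD_feasible C h cstar w /\ s = \sum_(i < N) w i].

Definition fETD (R : realType) N (C : {set concept N}) : R :=
  \big[Num.max/0]_(h : concept N) fETD_at R C h.

Fixpoint read_all N (s : seq 'I_N) (h : concept N) : dtree N :=
  match s with
  | [::] => Output h
  | i :: s' =>
      Query i (fun b => read_all s' [ffun j => if j == i then b else h j])
  end.

Lemma read_all_run N (s : seq 'I_N) (h c : concept N) :
  dtree_run (read_all s h) c = [ffun j => if j \in s then c j else h j].
Proof.
elim: s h => [|i s IHs] h /=; first by apply/ffunP => j; rewrite ffunE.
rewrite IHs; apply/ffunP => j; rewrite !ffunE inE.
by case: (j \in s); case: eqP => [->|].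
Qed.

Lemma read_all_cost N (s : seq 'I_N) (h c : concept N) :
  dtree_cost (read_all s h) c = size s.
Proof. by elim: s h => [//|i s IHs] h /=; rewrite IHs. Qed.

Lemma RQ_exists (R : realType) N (C : {set concept N}) :
  exists T, exists A : rlearner R N, rlearns C T A.
Proof.
pose t : dtree N := read_all (enum 'I_N) [ffun=> false].
have p0 (k : 'I_1) : 0 <= 1 :> R by [].
have p1 : \sum_(k < 1) (1 : R) = 1 by rewrite big_ord1.
exists N, (@RLearner R N 1 (fun=> 1) (fun=> t) p0 p1) => c _; split=> [k|].
  by rewrite /= read_all_cost size_enum_ord.
rewrite /rlearner_success /= (eq_bigl xpredT) => [|k].
  by rewrite big_ord1 ler_pdivrMr ?mul1r ?ler_nat.
by rewrite read_all_run; apply/eqP/ffunP => j; rewrite ffunE mem_enum.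
Qed.

Lemma RQP (R : realType) N (C : {set concept N}) :
  (exists A : rlearner R N, rlearns C (RQ R C) A) /\
  forall T (A : rlearner R N), rlearns C T A -> (RQ R C <= T)%N.
Proof.
have [RC minR] := minimum_natP (RQ_exists R C).
by split=> // T A lA; apply: minR; exists A.
Qed.

Lemma basis_map_ket (R : realType) (X : finType) (f : X -> X) (x : X) :
  basis_map_mx R f *m ket R x = ket R (f x).
Proof.
apply/colP => a; rewrite /ket -colE !mxE enum_rankK andbT.
by rewrite -(inj_eq enum_rank_inj) enum_valK.
Qed.

Lemma basis_map_unitary (R : realType) (X : finType) (f : X -> X) :
  injective f -> basis_map_mx R f \is unitarymx.
Proof.
move=> injf; rewrite -trmxC_unitary; apply/unitarymxP/matrixP => a b.
rewrite !mxE (bigD1 (enum_rank (f (enum_val a)))) //= !mxE enum_rankK eqxx.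
rewrite conjC1 mul1r big1 ?addr0 => [|k nk]; last first.
  have -> : (basis_map_mx R f ^t*) a k = 0; last by rewrite mul0r.
  rewrite !mxE; case: eqP => [fa|_]; last by rewrite conjC0.
  by rewrite -fa enum_valK eqxx in nk.
by rewrite conjCK (inj_eq injf) (inj_eq enum_val_inj).
Qed.

(* Between two queries: exchange the answer bit with bit i of the workspace,
   then increment the query index i. *)
Definition store N (x : qbasis N (concept N)) : qbasis N (concept N) :=
  (ordS x.1.1, x.2 x.1.1, [ffun j => if j == x.1.1 then x.1.2 else x.2 j]).

Lemma store_inj N : injective (@store N).
Proof.
move=> [[i b] w] [[i' b'] w'] e.
have /ordS_inj /= ii' := congr1 (fun x => x.1.1) e; subst i'.
have /= wi := congr1 (fun x => x.1.2) e.
have /ffunP /= ww' := congr1 snd e.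
have := ww' i; rewrite !ffunE eqxx => ->; congr (_, _).
by apply/ffunP => j; have := ww' j; rewrite !ffunE; case: eqP => [->|].
Qed.

Lemma QQ_exists (R : realType) N (C : {set concept N}) : (0 < N)%N ->
  exists T, exists A : qlearner R N, qlearns C T A.
Proof.
case: N C => // n C _.
pose W : finType := concept n.+1; pose X := qbasis n.+1 W.
pose x0 : X := (ord0, false, [ffun=> false]).
pose U t := if t is 0 then 1%:M else basis_map_mx R (@store n.+1).
pose M (h : concept n.+1) : 'M[R[i]]_#|X| :=
  \matrix_(a, b) ((a == b) && ((enum_val a).2 == h))%:R.
have UP t : U t \is unitarymx.
  case: t => [|t]; last exact/basis_map_unitary/store_inj.
  by apply/unitarymxP; rewrite trmx1 map_mx1 mulmx1.
have MP : \sum_h (M h)^t* *m M h = 1%:M.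
  apply/matrixP => a b; rewrite summxE (bigD1 (enum_val a).2) //= !mxE.
  rewrite (bigD1 a) //= !mxE !eqxx conjC1 mul1r andbT big1 => [|k ka]; last first.
    by rewrite !mxE (negbTE ka) conjC0 mul0r.
  rewrite addr0 big1 ?addr0 // => h hP.
  rewrite !mxE big1 // => k _; rewrite !mxE.
  case: eqP => [->|_]; last by rewrite conjC0 mul0r.
  by rewrite eq_sym (negbTE hP) conjC0 mul0r.
pose A := @QLearner R n.+1 W x0 U M UP MP.
exists n.+1, A => c _.
have stateE t : (t <= n.+1)%N -> qlearner_state A c t =
    ket R ((inZp t : 'I_n.+1), false, [ffun j : 'I_n.+1 => (j < t)%N && c j]).
  elim: t => [_|t IHt tn] /=.
    rewrite mul1mx; congr (ket R (_, _)); first by congr pair; apply: val_inj.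
  rewrite IHt 1?ltnW // /oracle !basis_map_ket; congr ket.
  have vt : (inZp t : 'I_n.+1) = t :> nat by rewrite /= modn_small.
  rewrite /store /query_basis /=; congr (_, _, _).
  - by apply/val_inj; rewrite /= (modn_small tn).
  - by rewrite ffunE vt ltnn.
  - apply/ffunP => j; rewrite !ffunE ltnS.
    have -> : (j == inZp t) = (j == t :> nat) by rewrite -val_eqE /= modn_small.
    by case: ltngtP => //= jt; congr (c _); apply/val_inj; rewrite /= modn_small.
rewrite /qlearner_success stateE //; set x := (_, _, _).
have x2 : x.2 = c by apply/ffunP => j; rewrite ffunE ltn_ord.
rewrite (bigD1 (enum_rank x)) //= /ket -colE !mxE eqxx enum_rankK x2 eqxx.
rewrite normr1 expr1n (@le_trans _ _ 1) // ?lerDl ?sumr_ge0 //.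
by rewrite ler_pdivrMr ?mul1r ?ler_nat.
Qed.

Lemma QQP (R : realType) N (C : {set concept N}) : (0 < N)%N ->
  (exists A : qlearner R N, qlearns C (QQ R C) A) /\
  forall T (A : qlearner R N), qlearns C T A -> (QQ R C <= T)%N.
Proof.
move=> N0; have [QC minQ] := minimum_natP (QQ_exists R C N0).
by split=> // T A lA; apply: minQ; exists A.
Qed.

(* Main.v *)
Require Import Defs.
From mathcomp Require Import all_boot all_order all_algebra.
From mathcomp Require Import all_classical all_reals all_analysis.
From mathcomp Require Import complex ring lra.

(* Quantum lower bound: run a T-query learner on an arbitrary oracle h, and let
   c* be its most likely output in C. The weights w_i = O(T) * (total query mass
   of the run at i) have sum O(T^2), and by the hybrid argument every c in C
   other than c* satisfies the teaching constraint, since otherwise the runs on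
   c and on h would have almost the same output; hence fETD(C) = O(T^2).
   Randomized upper bound: under a prior on C whose posterior is not concentrated
   on one concept, some query has both answers of conditional probability at
   least fgamma/5, so it lowers the posterior entropy, initially at most ln |C|,
   by at least a constant times fgamma * ln (1/fgamma + 1) on average. This
   yields a good decision tree for each prior, and the multiplicative weights
   method turns these trees into one randomized learner.
   The two parameters are related by 1/fgamma <= 2 fETD, which is enough to pass
   from either form of the two bounds to the other. *)

Set Implicit Arguments.
Unset Strict Implicit.
Unset Printing Implicit Defensive.

Import Order.TTheory GRing.Theory Num.Theory.

Local Open Scope ring_scope.
Local Open Scope sesquilinear_scope.

(** * Teaching and splitting *)

Section SplittingTeaching.
Variables (R : realType) (N : nat) (C : {set concept N}).
Implicit Types (mu : concept N -> R) (c h : concept N).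

Lemma massE mu i b : mass mu (Defs.restrict C i b) = \sum_(c in C | c i == b) mu c.
Proof. by apply: eq_bigl => c; rewrite inE. Qed.

Lemma mass_split mu i :
  \sum_(c in C) mu c =
  mass mu (Defs.restrict C i false) + mass mu (Defs.restrict C i true).
Proof.
rewrite !massE (bigID (fun c : concept N => c i == false)) /=; congr (_ + _).
by apply: eq_bigl => c; case: (c i).
Qed.

(** Keeps the infimum in [fETD_at] over a nonempty set. Taking [cstar = h] when [h] lies in [C]
    leaves only concepts that differ from [h] somewhere. *)
Lemma fETD_constant_feasible h : (0 < #|C|)%N ->
  exists cstar, fETD_feasible C h cstar (fun=> 1 : R).
Proof.
move=> /card_gt0P [c0 c0C].
exists (if h \in C then h else c0); split=> // [|c cC cN].
  by case: ifP.
have /eqP/ffunP ch : c != h.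
  by apply/eqP => ch; subst h; rewrite cC eqxx in cN.
have [i ci] : exists i, c i != h i.
  apply/existsP; apply: contra_notT ch; rewrite negb_exists => /forallP e i.
  by apply/eqP; move: (e i); rewrite negbK.
by rewrite (bigD1 i) //= lerDl sumr_ge0.
Qed.

Lemma le_fETD h x : (0 < #|C|)%N ->
  (forall cstar (w : 'I_N -> R), fETD_feasible C h cstar w -> x <= \sum_i w i) ->
  x <= fETD R C.
Proof.
move=> C0 lbx; apply: (@le_trans _ _ (fETD_at R C h)); last exact: le_bigmax.
apply: lb_le_inf; last by move=> _ [cstar [w [fw ->]]]; exact: lbx fw.
have [cstar fc] := fETD_constant_feasible h C0.
by exists (\sum_(i < N) 1), cstar, (fun=> 1).
Qed.

Definition bounded_dist mu := is_dist C mu /\ forall c, c \in C -> mu c <= 1 / 2.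

Lemma split_value_ge mu i :
  Num.min (mass mu (Defs.restrict C i false)) (mass mu (Defs.restrict C i true))
  <= split_value C mu.
Proof. exact: (@le_bigmax _ _ _ _ (fun i => Num.min _ _)). Qed.

Lemma split_value_ge0 mu : 0 <= split_value C mu.
Proof. exact: bigmax_ge_id. Qed.

(* For [h] the majority vote of [mu], all of [mu] but at most 1/2 is charged by
   each feasible [w], whereas every index carries disagreement at most
   [split_value C mu]. *)
Lemma teaching_split_value mu : (0 < #|C|)%N -> bounded_dist mu ->
  1 / 2 <= split_value C mu * fETD R C.
Proof.
move=> C0 [[mu0 mu1] mu2]; set s := split_value C mu.
pose h : concept N := [ffun i => mass mu (Defs.restrict C i false)
                                 <= mass mu (Defs.restrict C i true)].
have hs i : \sum_(c in C | c i != h i) mu c <= s.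
  have -> : \sum_(c in C | c i != h i) mu c = mass mu (Defs.restrict C i (~~ h i)).
    by rewrite massE; apply: eq_bigl => c; case: (c i); case: (h i).
  apply: le_trans (split_value_ge mu i); rewrite ffunE.
  by case: (leP (mass mu (Defs.restrict C i false))) => _ /=.
have feas cstar (w : 'I_N -> R) :
    fETD_feasible C h cstar w -> 1 / 2 <= s * \sum_i w i.
  case=> cC w0 w1.
  apply: (@le_trans _ _ (\sum_(c in C) mu c * \sum_(i < N | c i != h i) w i)).
    apply: (@le_trans _ _ (\sum_(c in C | c != cstar) mu c)).
      move: mu1; rewrite (bigD1 cstar) //= => mu1.
      by have := mu2 _ cC; lra.
    rewrite [leRHS](bigID (fun c => c != cstar)) /= -[leLHS]addr0.
    apply: lerD; last first.
      by apply: sumr_ge0 => c /andP[? _]; rewrite mulr_ge0 ?mu0 ?sumr_ge0.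
    by apply: ler_sum => c /andP[? ?]; rewrite ler_peMr ?mu0 ?w1.
  under eq_bigr do rewrite big_distrr /=.
  rewrite (exchange_big_dep xpredT) //= big_distrr /=.
  by apply: ler_sum => i _; rewrite -big_distrl /= ler_wpM2r ?hs.
(* Dividing by [s] needs [s > 0]; if [s = 0], the constant weight would give 1/2 <= 0. *)
have [s0|s0] := ltrP 0 s; last first.
  have [cstar /feas] := fETD_constant_feasible h C0.
  have -> : s = 0 by apply/le_anti; rewrite s0 split_value_ge0.
  by rewrite mul0r; lra.
rewrite [leRHS]mulrC -ler_pdivrMr //; apply: (le_fETD (h := h)) => // cstar w fw.
by rewrite ler_pdivrMr // [leRHS]mulrC; exact: feas fw.
Qed.

Hypothesis card_ge2 : (2 <= #|C|)%N.

Let C_gt0 : (0 < #|C|)%N. Proof. exact: leq_trans card_ge2. Qed.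

Lemma uniform_bounded_dist : bounded_dist (fun=> #|C|%:R^-1).
Proof.
split; first split=> [c _|]; first by rewrite invr_ge0.
  by rewrite sumr_const -[LHS]mulr_natl divff // pnatr_eq0 -lt0n.
by move=> c _; rewrite div1r lef_pV2 ?posrE ?ltr0n // ler_nat.
Qed.

Lemma fgamma_le_split_value mu : bounded_dist mu -> fgamma R C <= split_value C mu.
Proof.
move=> Bmu; apply: ge_inf; last by exists mu.
by exists 0 => _ [nu _ <-]; exact: split_value_ge0.
Qed.

(** Passes [teaching_split_value] to the infimum over [mu]. The uniform distribution supplies both
    [fETD > 0], needed for dividing, and a member of the set. *)
Lemma fETD_fgamma : 1 / 2 <= fgamma R C * fETD R C.
Proof.
have BD := teaching_split_value C_gt0 uniform_bounded_dist.
have F0 : 0 < fETD R C.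
  rewrite lt_neqAle bigmax_ge_id andbT; apply/eqP => F0.
  by move: BD; rewrite /= -F0 mulr0; lra.
rewrite -ler_pdivrMr //; apply: lb_le_inf.
  by exists (split_value C (fun=> #|C|%:R^-1)), (fun=> #|C|%:R^-1) => //;
    exact: uniform_bounded_dist.
by move=> _ [mu Bmu <-]; rewrite ler_pdivrMr //; exact: teaching_split_value.
Qed.

Lemma fgamma_gt0 : 0 < fgamma R C.
Proof.
have F0 : 0 <= fETD R C by exact: bigmax_ge_id.
have := fETD_fgamma; rewrite ltNge => H; apply/negP => g0.
by have := mulr_le0_ge0 g0 F0; lra.
Qed.

Lemma fgamma_le_half : fgamma R C <= 1 / 2.
Proof.
apply: le_trans (fgamma_le_split_value uniform_bounded_dist) _.
apply/bigmax_leP; split=> [|i _]; first lra.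
have [_] := uniform_bounded_dist.1; rewrite (mass_split _ i).
by rewrite ge_min; case: leP => //=; lra.
Qed.

Lemma inv_fgamma_le : 1 / fgamma R C <= 2 * fETD R C.
Proof. by rewrite ler_pdivrMr ?fgamma_gt0 //; have := fETD_fgamma; lra. Qed.

(** The maximum in [split_value] has default 0, so it is the positivity of [fgamma] that yields an
    actual index. *)
Lemma splitting_index mu : bounded_dist mu ->
  exists i, forall b, fgamma R C <= \sum_(c in C | c i == b) mu c.
Proof.
move=> /fgamma_le_split_value; rewrite /split_value leNgt => /negP H.
have [j] : exists i, fgamma R C <= Num.min (mass mu (Defs.restrict C i false))
    (mass mu (Defs.restrict C i true)).
  apply: contrapT => nex; apply: H; apply/bigmax_ltP; split=> [|i _].
    exact: fgamma_gt0.
  by rewrite ltNge; apply/negP => ?; apply: nex; exists i.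
by rewrite le_min !massE => /andP[? ?]; exists j; case.
Qed.

End SplittingTeaching.

(** * Bayesian learner and minimax *)

Section Entropy.
Variable R : realType.
Implicit Types x y a b m rho : R.

Lemma ln2_ge_half : 1 / 2 <= ln 2 :> R.
Proof.
have : ln (1 + - (1 / 2)) <= - (1 / 2) :> R by apply: le_ln1Dx; lra.
have -> : 1 + - (1 / 2) = 2^-1 :> R by lra.
by rewrite lnV ?posrE //; lra.
Qed.

Definition xlnx x := x * ln x.

Lemma xlnx0 : xlnx 0 = 0. Proof. exact: mul0r. Qed.

(* With [x = s * rho], the claim compares [s * ln x^-1] to
   [ln rho^-1 = ln x^-1 + ln s], where [ln x^-1 >= ln 2] and [ln s <= s]. *)
Lemma mul_lnV_ge rho x : 0 < rho -> rho <= x -> x <= 1 / 2 ->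
  1 / 4 * (rho * ln rho^-1) <= x * ln x^-1.
Proof.
move=> r0 rx x2; have x0 : 0 < x by exact: lt_le_trans rx.
pose s := x / rho; have s1 : 1 <= s by rewrite ler_pdivlMr // mul1r.
have xE : x = s * rho by rewrite /s divfK // gt_eqF.
have s0 : 0 < s by lra.
have lrho : ln rho^-1 = ln x^-1 + ln s.
  by rewrite !lnV ?posrE // xE lnM ?posrE //; lra.
have lx : 1 / 2 <= ln x^-1.
  apply: le_trans ln2_ge_half _; rewrite ler_ln ?posrE ?invr_gt0 //.
  by rewrite -[leLHS]invrK lef_pV2 ?posrE ?invr_gt0 //; lra.
have ls : ln s <= s by exact/ltW/ln_sublinear.
move: (ln x^-1) lrho lx => l -> lx.
by rewrite xE -[s * rho * l]mulrA mulrCA [leRHS]mulrCA ler_pM2l //; nra.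
Qed.

(** The split releases entropy [a ln (m/a) + b ln (m/b)]. Only the term of the smaller part [a] is
    kept: [a/m] lies between [rho] and 1/2, so [mul_lnV_ge] applies. *)
Lemma xlnx_split rho m a b : 0 < rho -> 0 < m -> a + b = m ->
  rho * m <= a -> rho * m <= b ->
  1 / 4 * (rho * ln rho^-1) * m <= xlnx m - xlnx a - xlnx b.
Proof.
move=> r0 m0; wlog ab : a b / a <= b => [H|] abm ra rb.
  have [|/ltW] := leP a b => ab; first exact: H.
  have -> : xlnx m - xlnx a - xlnx b = xlnx m - xlnx b - xlnx a by lra.
  by apply: H => //; rewrite addrC.
have rm0 : 0 < rho * m by exact: mulr_gt0.
have a0 : 0 < a by lra. have b0 : 0 < b by lra.
have mlb : ln b <= ln m by rewrite ler_ln ?posrE //; lra.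
have : 1 / 4 * (rho * ln rho^-1) <= a / m * ln (a / m)^-1.
  apply: mul_lnV_ge => //; first by rewrite ler_pdivlMr.
  by rewrite ler_pdivrMr //; lra.
rewrite invf_div ln_div ?posrE // -(ler_pM2r m0); move/le_trans; apply.
rewrite mulrAC divfK ?gt_eqF // /xlnx -subr_ge0.
have -> : m * ln m - a * ln a - b * ln b - a * (ln m - ln a) = b * (ln m - ln b).
  by rewrite -[X in X * ln m - _ - _ - _]abm; ring.
by rewrite mulr_ge0 ?subr_ge0 // ltW.
Qed.

(** The tangent of [ln] at [x + 1] bounds [ln (y + 1)], and [x / (x + 1) <= ln (x + 1)] absorbs the
    increment. *)
Lemma ln_ratio_monotone x y : 0 < x -> x <= y -> x / ln (x + 1) <= y / ln (y + 1).
Proof.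
move=> x0 xy; have y0 : 0 < y by lra.
have lx0 : 0 < ln (x + 1) by apply: ln_gt0; lra.
have ly0 : 0 < ln (y + 1) by apply: ln_gt0; lra.
rewrite ler_pdivrMr // mulrAC ler_pdivlMr //.
have x10 : 0 < x + 1 by lra.
have d0 : 0 <= (y - x) / (x + 1) by rewrite divr_ge0 //; lra.
have lxy : ln (y + 1) <= ln (x + 1) + (y - x) / (x + 1).
  have -> : y + 1 = (x + 1) * (1 + (y - x) / (x + 1)) by field; lra.
  rewrite lnM ?posrE //; last lra.
  by rewrite lerD2l; apply: le_ln1Dx; lra.
have lx : x / (x + 1) <= ln (x + 1).
  have : ln (1 + - (x / (x + 1))) <= - (x / (x + 1)).
    by apply: le_ln1Dx; rewrite ltrN2 ltr_pdivrMr //; lra.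
  have -> : 1 + - (x / (x + 1)) = (x + 1)^-1 by field; lra.
  by rewrite lnV ?posrE //; lra.
have : x * ln (y + 1) <= x * (ln (x + 1) + (y - x) / (x + 1)).
  by rewrite ler_pM2l.
move/le_trans; apply.
have -> : x * (ln (x + 1) + (y - x) / (x + 1)) =
  x * ln (x + 1) + (y - x) * (x / (x + 1)) by field; lra.
by nra.
Qed.

End Entropy.

(** * Decision trees for a fixed prior *)

Section Bayes.
Variables (R : realType) (N : nat) (C : {set concept N}).
Implicit Types (mu : concept N -> R) (t : dtree N) (c : concept N).

Definition tree_depth_le t T := forall c, (dtree_cost t c <= T)%N.

Definition success_mass mu t := \sum_(c in C | dtree_run t c == c) mu c.

(** The posterior after answer [b], left unnormalised so that the masses of the two answers add
    up. *)
Definition branch_weight mu (i : 'I_N) (b : bool) c : R :=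
  if c i == b then mu c else 0.

Lemma sum_branch_weight mu i b :
  \sum_(c in C) branch_weight mu i b c = \sum_(c in C | c i == b) mu c.
Proof. by rewrite big_mkcondr. Qed.

Lemma sum_branch_split (F : (concept N -> R) -> concept N -> R) mu i :
  (forall c b, F (branch_weight mu i b) c = if c i == b then F mu c else 0) ->
  \sum_(c in C) F mu c = \sum_(c in C) F (branch_weight mu i true) c +
    \sum_(c in C) F (branch_weight mu i false) c.
Proof.
move=> FE; rewrite -big_split /=; apply: eq_bigr => c _.
by rewrite !FE; case: (c i); rewrite /= ?addr0 ?add0r.
Qed.

Definition total mu := \sum_(c in C) mu c.

(* Total mass times Shannon entropy (in nats) of the normalised weights; a query
   splits it without dividing by the masses of the two answers. *)
Definition entropy mu := xlnx (total mu) - \sum_(c in C) xlnx (mu c).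

Lemma success_mass_query mu i (next : bool -> dtree N) :
  success_mass mu (Query i next) =
  success_mass (branch_weight mu i true) (next true) +
  success_mass (branch_weight mu i false) (next false).
Proof.
rewrite /success_mass !big_mkcondr /= -big_split /=; apply: eq_bigr => c _.
rewrite /branch_weight; case: (c i); case: ifP; case: ifP => _ _ //=;
  by rewrite ?addr0 ?add0r.
Qed.

Lemma entropy_query mu i :
  entropy mu = entropy (branch_weight mu i true) +
    entropy (branch_weight mu i false) +
    (xlnx (total mu) - xlnx (total (branch_weight mu i true))
       - xlnx (total (branch_weight mu i false))).
Proof.
rewrite /entropy (@sum_branch_split (fun mu c => xlnx (mu c)) mu i); first lra.
by move=> c b; rewrite /branch_weight; case: ifP => //; rewrite xlnx0.
Qed.

(** Gibbs' inequality against the uniform distribution: [ln x <= x - 1] at [x = m / n / mu c], and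
    the corrections [m / n - mu c] sum to 0. *)
Lemma entropy_le mu : (forall c, 0 <= mu c) ->
  entropy mu <= total mu * ln #|C|%:R.
Proof.
move=> mu0; set m := total mu; set n : R := #|C|%:R.
have m0 : 0 <= m by exact: sumr_ge0.
have [mE|mp] := eqVneq m 0.
  rewrite /entropy -/m mE xlnx0 mul0r sub0r big1 ?oppr0 // => c cC.
  have /psumr_eq0P -> // : m = 0 by []. by rewrite xlnx0.
have {}m0 : 0 < m by rewrite lt_neqAle eq_sym mp.
have n0 : 0 < n.
  rewrite ltr0n lt0n; apply: contra_neq mp => /eqP; rewrite cards_eq0 => /eqP C0.
  by rewrite /m /total C0 big_set0.
have step c : c \in C -> mu c * ln m - xlnx (mu c) <= mu c * ln n + (m / n - mu c).
  move=> cC; have [cE|cp] := eqVneq (mu c) 0.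
    by rewrite cE /xlnx !mul0r subrr add0r subr0 divr_ge0 // ltW.
  have {}cp : 0 < mu c by rewrite lt_neqAle eq_sym cp mu0.
  have q0 : 0 < m / n / mu c by rewrite !divr_gt0.
  have : ln (1 + (m / n / mu c - 1)) <= m / n / mu c - 1 by apply: le_ln1Dx; lra.
  have -> : 1 + (m / n / mu c - 1) = m / n / mu c by lra.
  rewrite !ln_div ?posrE ?divr_gt0 // -(ler_pM2l cp) /xlnx.
  have -> : mu c * (m / n / mu c - 1) = m / n - mu c by field; rewrite !gt_eqF.
  lra.
rewrite /entropy -/m {1}/xlnx {1}/m /total big_distrl /= -sumrB.
apply: le_trans (ler_sum _ step) _.
rewrite big_split /= -big_distrl /= sumrB sumr_const -/(total mu) -/m -mulr_natr.
by rewrite divfK ?gt_eqF // subrr addr0.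
Qed.

Lemma entropy_ge0 mu : (forall c, 0 <= mu c) -> 0 <= entropy mu.
Proof.
move=> mu0; rewrite /entropy /xlnx /total big_distrl /= -sumrB.
apply: sumr_ge0 => c cC; rewrite -mulrBr.
have [->|cp] := eqVneq (mu c) 0; first by rewrite mul0r.
have {}cp : 0 < mu c by rewrite lt_neqAle eq_sym cp mu0.
have cm : mu c <= \sum_(c in C) mu c by rewrite (bigD1 c) //= lerDl sumr_ge0.
by rewrite mulr_ge0 ?subr_ge0 ?ler_ln ?posrE // (lt_le_trans cp).
Qed.

Variable rho : R.
Hypothesis rho01 : 0 < rho <= 1.
Hypothesis splitting : forall mu, (forall c, 0 <= mu c) -> 0 < total mu ->
  (forall c, c \in C -> mu c <= 9 / 10 * total mu) ->
  exists i, forall b, rho * total mu <= \sum_(c in C | c i == b) mu c.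
Hypothesis card_ge2 : (2 <= #|C|)%N.

Let gain := 1 / 4 * (rho * ln rho^-1).

Let gain_ge0 : 0 <= gain.
Proof.
have /andP[r0 r1] := rho01; rewrite mulr_ge0 ?mulr_ge0 ?(ltW r0) //.
by rewrite ln_ge0 // -[leLHS]invr1 lef_pV2 ?posrE.
Qed.

(* [u] is the mass of the targets still unresolved after [T] queries: the tree
   stops once a single concept carries 9/10 of the remaining mass, and each query
   made before that lowers the entropy by [gain] times the remaining mass. *)
Lemma bayes_tree T mu : (forall c, 0 <= mu c) ->
  exists t u, [/\ tree_depth_le t T, u <= total mu,
    9 / 10 * (total mu - u) <= success_mass mu t & T%:R * gain * u <= entropy mu].
Proof.
have /andP[r0 r1] := rho01.
elim: T mu => [|T IHT] mu mu0; have m0 : 0 <= total mu by exact: sumr_ge0.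
  exists (Output [ffun=> false]), (total mu); split=> //.
    by rewrite subrr mulr0 sumr_ge0.
  by rewrite !mul0r entropy_ge0.
have [[c cC cm]|nstop] := pselect (exists2 c, c \in C & 9 / 10 * total mu <= mu c).
  exists (Output c), 0; split=> //; last by rewrite mulr0 entropy_ge0.
  by rewrite subr0 /success_mass (bigD1 c) /= ?cC ?eqxx // ler_wpDr ?sumr_ge0.
have mlt c : c \in C -> mu c < 9 / 10 * total mu.
  by move=> cC; rewrite ltNge; apply/negP => cm; apply: nstop; exists c.
have mle c : c \in C -> mu c <= 9 / 10 * total mu by move=> /mlt/ltW.
have {}m0 : 0 < total mu.
  have /card_gt0P [c cC] : (0 < #|C|)%N by exact: leq_trans card_ge2.
  by have := mlt c cC; have := mu0 c; lra.
have [i isplit] := splitting mu0 m0 mle.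
have nu0 b c : 0 <= branch_weight mu i b c by rewrite /branch_weight; case: ifP.
have [t1 [u1 [d1 um1 s1 e1]]] := IHT _ (nu0 true).
have [t0 [u0 [d0 um0 s0 e0]]] := IHT _ (nu0 false).
have mE : total (branch_weight mu i true) + total (branch_weight mu i false)
    = total mu.
  rewrite /total [RHS](@sum_branch_split (fun mu c => mu c) mu i) //.
have mb b : rho * total mu <= total (branch_weight mu i b).
  by rewrite [leRHS]sum_branch_weight.
have gm := xlnx_split r0 m0 mE (mb true) (mb false).
exists (Query i (fun b => if b then t1 else t0)), (u1 + u0); split.
- by move=> c /=; rewrite ltnS; case: (c i); [exact: d1|exact: d0].
- lra.
- by rewrite success_mass_query /=; lra.
- rewrite (entropy_query _ i) -natr1.
  have : gain * (u1 + u0) <= gain * total mu by rewrite ler_wpM2l //; lra.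
  by rewrite -/gain in gm; lra.
Qed.

(** By [entropy_le], the unresolved mass [u] is at most a tenth of the total, so the success is at
    least 9/10 * 9/10 = 81/100 of it. *)
Lemma bayes_tree_success T mu : (forall c, 0 <= mu c) ->
  10 * ln #|C|%:R <= T%:R * gain ->
  exists2 t, tree_depth_le t T & 4 / 5 * total mu <= success_mass mu t.
Proof.
move=> mu0 Tg; have [t [u [dt um st et]]] := bayes_tree T mu0.
exists t => //; apply: le_trans st.
have m0 : 0 <= total mu by exact: sumr_ge0.
have ln0 : 0 < ln #|C|%:R :> R by rewrite ln_gt0 // ltr1n.
have Tg0 : 0 < T%:R * gain by lra.
suff : u <= total mu / 10 by lra.
rewrite -(ler_pM2l Tg0); apply: le_trans et _; apply: le_trans (entropy_le mu0) _.
by have := ler_wpM2r m0 Tg; lra.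
Qed.

End Bayes.

(* Minimax by multiplicative weights: each new tree is good against the weights
   in which every earlier failure on a concept has doubled its weight. *)
Section Minimax.
Variables (R : realType) (N : nat) (C : {set concept N}) (T : nat).
Hypothesis average_case : forall mu : concept N -> R, (forall c, 0 <= mu c) ->
  exists2 t, tree_depth_le t T & 4 / 5 * total C mu <= success_mass C mu t.

Let bounded_tree := {t : dtree N | tree_depth_le t T}.

Let failures (s : seq bounded_tree) (c : concept N) :=
  count (fun t => dtree_run (sval t) c != c) s.

(** Doubling the failed weights turns the total into [2 * total - success_mass], at most 2 - 4/5 =
    6/5 of the old total. *)
Lemma doubling_weights M : exists2 s : seq bounded_tree, size s = M &
  \sum_(c in C) 2 ^+ failures s c <= (6 / 5) ^+ M * #|C|%:R :> R.
Proof.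
elim: M => [|M [s sM IHs]].
  by exists [::] => //=; rewrite mul1r sumr_const expr0.
have w0 c : 0 <= 2 ^+ failures s c :> R by rewrite exprn_ge0.
have [t dt st] := average_case w0.
exists (exist _ t dt :: s); first by rewrite /= sM.
rewrite exprS -mulrA.
apply: (@le_trans _ _ (6 / 5 * \sum_(c in C) 2 ^+ failures s c)).
  have -> : \sum_(c in C) 2 ^+ failures (exist _ t dt :: s) c =
    2 * total C (fun c => 2 ^+ failures s c)
      - success_mass C (fun c => 2 ^+ failures s c) t :> R.
    rewrite /success_mass big_mkcondr /= /total big_distrr /= -sumrB.
    apply: eq_bigr => c _; rewrite exprD.
    by case: eqP => _ /=; rewrite ?expr0 ?expr1 ?mul1r; ring.
  by move: st; rewrite /total; lra.
by rewrite ler_wpM2l //; lra.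
Qed.

(** Bernoulli's inequality: the base, which is 2 / (6/5)^3, exceeds 1 + 1/8. *)
Let natr_lt_expr k : k%:R < (250 / 216) ^+ (8 * k) :> R.
Proof.
suff : forall j, 1 + j%:R / 8 <= (250 / 216) ^+ j :> R.
  by move/(_ (8 * k)%N); apply: lt_le_trans; rewrite natrM; lra.
elim=> [|j IHj]; first by rewrite expr0 mul0r addr0.
by rewrite exprS -natr1; have : 0 <= j%:R :> R by []; nra.
Qed.

Let two_factor : 2 = (6 / 5) ^+ 3 * (250 / 216) :> R. Proof. lra. Qed.

(** The learner draws one of [24 n] trees uniformly. A concept failed by [8 n] of them would alone
    weigh [2^(8n)], more than the bound [(6/5)^(24n) n] on all weights; so fewer than a third
    fail. *)
Lemma worst_case_learner : exists A : rlearner R N, rlearns C T A.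
Proof.
have [C0|C0] := posnP #|C|.
  have [A _] := (RQP R C).1; exists A => c.
  by rewrite (cards0_eq C0) inE.
pose n := #|C|; have [s sM sw] := doubling_weights (3 * (8 * n)).
have fail_lt c : c \in C -> (failures s c < 8 * n)%N.
  move=> cC; rewrite ltnNge; apply/negP => fc.
  have : 2 ^+ (8 * n) <= (6 / 5) ^+ (3 * (8 * n)) * n%:R :> R.
    apply: le_trans sw; rewrite (bigD1 c) //= ler_wpDr //.
      by apply: sumr_ge0 => d _; rewrite exprn_ge0.
    by rewrite ler_eXn2l // ltr1n.
  have -> : 2 ^+ (8 * n) = (6 / 5) ^+ (3 * (8 * n)) * (250 / 216) ^+ (8 * n) :> R.
    by rewrite [(6 / 5) ^+ _]exprM -exprMn -two_factor.
  rewrite ler_pM2l ?exprn_gt0 //; apply/negP; rewrite -ltNge.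
  exact: natr_lt_expr.
have s0 : (0 < size s)%N by rewrite sM !muln_gt0.
have p0 (k : 'I_(size s)) : 0 <= (size s)%:R^-1 :> R by rewrite invr_ge0.
have p1 : \sum_(k < size s) (size s)%:R^-1 = 1 :> R.
  by rewrite sumr_const card_ord -[LHS]mulr_natl divff // pnatr_eq0 -lt0n.
exists (@RLearner R N (size s) _ (fun k => sval (tnth (in_tuple s) k)) p0 p1).
move=> c cC; split=> [k|] /=; first exact: (svalP (tnth (in_tuple s) k) c).
rewrite /rlearner_success /=.
rewrite -(big_tnth _ _ s (fun t => dtree_run (sval t) c == c) (fun=> _)).
rewrite big_const_seq iter_addr_0 -[leRHS]mulr_natl.
rewrite ler_pdivlMr ?ltr0n //.
have := fail_lt c cC; rewrite -(ltr_nat R) => fn.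
have cE : (size s)%:R = (failures s c)%:R +
    (count (fun t => dtree_run (sval t) c == c) s)%:R :> R.
  by rewrite -natrD addnC /failures count_predC.
have sE : (size s)%:R = 3 * (8 * n)%:R :> R by rewrite sM natrM.
by clear -fn sE cE; lra.
Qed.
End Minimax.

(** * Hybrid argument *)

Lemma mulmx_diff_split (S : pzRingType) m n p (A B : 'M[S]_(m, n))
    (u v : 'M[S]_(n, p)) :
  A *m u - B *m v = A *m (u - v) + (A *m v - B *m v).
Proof. by rewrite mulmxBr subrKA. Qed.

(** * Squared norms of complex vectors *)

Section NormSquare.
Variable R : realType.
Implicit Types (z : R[i]) (e : R).

(** The squared modulus, valued in [R] so that estimates take place in an ordered field. *)
Definition nsq z : R := complex.Re z ^+ 2 + complex.Im z ^+ 2.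

Lemma nsqE z : (nsq z)%:C%C = `|z| ^+ 2. Proof. exact: add_Re2_Im2. Qed.

Lemma nsq_ge0 z : 0 <= nsq z. Proof. by rewrite addr_ge0 ?sqr_ge0. Qed.

Lemma nsq0 : nsq 0 = 0. Proof. by rewrite /nsq /= expr0n addr0. Qed.

Lemma nsqN z : nsq (- z) = nsq z.
Proof. by case: z => a b; rewrite /nsq /= !sqrrN. Qed.

(** The right side minus the left is [nsq (e z - w) / e]. *)
Lemma nsqD_le e z w : 0 < e ->
  nsq (z + w) <= (1 + e) * nsq z + (1 + e^-1) * nsq w.
Proof.
move=> e0; case: z w => [a b] [c d]; rewrite /nsq /= -subr_ge0.
have -> : (1 + e) * (a ^+ 2 + b ^+ 2) + (1 + e^-1) * (c ^+ 2 + d ^+ 2) -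
    ((a + c) ^+ 2 + (b + d) ^+ 2) = ((e * a - c) ^+ 2 + (e * b - d) ^+ 2) / e.
  by field; lra.
by rewrite divr_ge0 ?addr_ge0 ?sqr_ge0 // ltW.
Qed.

Definition normsq n (v : 'cV[R[i]]_n) : R := \sum_a nsq (v a 0).

Lemma normsq_ge0 n (v : 'cV[R[i]]_n) : 0 <= normsq v.
Proof. by apply: sumr_ge0 => a _; exact: nsq_ge0. Qed.

Lemma normsqD_le n e (v w : 'cV[R[i]]_n) : 0 < e ->
  normsq (v + w) <= (1 + e) * normsq v + (1 + e^-1) * normsq w.
Proof.
move=> e0; rewrite /normsq !big_distrr -big_split /=; apply: ler_sum => a _.
by rewrite mxE nsqD_le.
Qed.

Lemma normsqE n (v : 'cV[R[i]]_n) : (normsq v)%:C%C = (v^t* *m v) 0 0.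
Proof.
rewrite mxE rmorph_sum; apply: eq_bigr => a _.
by rewrite /= nsqE normCK !mxE mulrC.
Qed.

Lemma normsq_unitary n (U : 'M[R[i]]_n) v :
  U \is unitarymx -> normsq (U *m v) = normsq v.
Proof.
rewrite -trmxC_unitary => /unitarymxP; rewrite trmxCK => UU.
suff : (normsq (U *m v))%:C%C = (normsq v)%:C%C by case.
by rewrite !normsqE trmx_mul map_mxM -mulmxA (mulmxA _ U) UU mul1mx.
Qed.

Lemma normsq_measure n (I : finType) (M : I -> 'M[R[i]]_n) v :
  \sum_h (M h)^t* *m M h = 1%:M -> \sum_h normsq (M h *m v) = normsq v.
Proof.
move=> MM; suff : (\sum_h normsq (M h *m v))%:C%C = (normsq v)%:C%C by case.
rewrite rmorph_sum /= normsqE -{3}[v]mul1mx -MM mulmx_suml mulmx_sumr summxE.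
by apply: eq_bigr => h _; rewrite normsqE trmx_mul map_mxM !mulmxA.
Qed.

Lemma normsq_measure_le n (I : finType) (M : I -> 'M[R[i]]_n) v h :
  \sum_h (M h)^t* *m M h = 1%:M -> normsq (M h *m v) <= normsq v.
Proof.
move=> MM; rewrite -(normsq_measure v MM) (bigD1 h) //= lerDl.
by apply: sumr_ge0 => *; exact: normsq_ge0.
Qed.

Lemma normsq_index (X : finType) (v : 'cV[R[i]]_#|X|) :
  normsq v = \sum_x nsq (v (enum_rank x) 0).
Proof.
rewrite /normsq (reindex enum_rank) //=.
by exists enum_val => x _; rewrite ?enum_rankK ?enum_valK.
Qed.

Lemma normsq_ket (X : finType) (x : X) : normsq (ket R x) = 1.
Proof.
rewrite normsq_index (bigD1 x) //= !mxE !eqxx big1 ?addr0 => [|y yx].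
  by rewrite /nsq /= expr1n expr0n addr0.
by rewrite !mxE (inj_eq enum_rank_inj) (negbTE yx) nsq0.
Qed.

End NormSquare.

(** * Query mass and the distance between two runs *)

Section Hybrid.
Variables (R : realType) (N : nat).
Implicit Types (c h : concept N) (W : finType).

Lemma query_basisK W c : involutive (@query_basis N W c).
Proof. by case=> [[i b] w]; rewrite /query_basis /= addbK. Qed.

Lemma oracle_unitary W c : oracle R W c \is unitarymx.
Proof. exact/basis_map_unitary/inv_inj/query_basisK. Qed.

Lemma oracleE W c (v : 'cV[R[i]]_#|qbasis N W|) x :
  (oracle R W c *m v) (enum_rank x) 0 = v (enum_rank (query_basis c x)) 0.
Proof.
rewrite mxE (bigD1 (enum_rank (query_basis c x))) //= mxE !enum_rankK.
rewrite query_basisK eqxx mul1r big1 ?addr0 // => b bx; rewrite mxE enum_rankK.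
case: eqP => [xb|_]; last by rewrite mul0r.
by rewrite xb query_basisK enum_valK eqxx in bx.
Qed.

Lemma oracle_diffE W c h (v : 'cV[R[i]]_#|qbasis N W|) x :
  (oracle R W c *m v - oracle R W h *m v) (enum_rank x) 0 =
  v (enum_rank (query_basis c x)) 0 - v (enum_rank (query_basis h x)) 0.
Proof. by rewrite -!oracleE [LHS]mxE [X in _ + X]mxE. Qed.

Definition query_mass W (v : 'cV[R[i]]_#|qbasis N W|) (i : 'I_N) : R :=
  \sum_(x | x.1.1 == i) nsq (v (enum_rank x) 0).

Lemma query_mass_ge0 W (v : 'cV[R[i]]_#|qbasis N W|) i : 0 <= query_mass v i.
Proof. by apply: sumr_ge0 => x _; exact: nsq_ge0. Qed.

Lemma sum_query_mass W (v : 'cV[R[i]]_#|qbasis N W|) (P : pred 'I_N) :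
  \sum_(i | P i) query_mass v i =
  \sum_(x : qbasis N W | P x.1.1) nsq (v (enum_rank x) 0).
Proof.
rewrite [RHS](partition_big (fun x : qbasis N W => x.1.1) P) //=.
apply: eq_bigr => i Pi; apply: eq_bigl => x.
by case: eqP => [->|]; rewrite ?Pi ?andbF.
Qed.

(** Amplitudes with a query index where [c] and [h] agree cancel. Each oracle permutes the others
    among themselves, and [nsq (a - b) <= 2 nsq a + 2 nsq b] gives the factor 4. *)
Lemma oracle_diff_le W c h (v : 'cV[R[i]]_#|qbasis N W|) :
  normsq (oracle R W c *m v - oracle R W h *m v) <=
  4 * \sum_(i | c i != h i) query_mass v i.
Proof.
pose D := fun x : qbasis N W => c x.1.1 != h x.1.1.
have queryD (g : concept N) :
    \sum_(x | D x) nsq (v (enum_rank (query_basis g x)) 0) =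
    \sum_(x | D x) nsq (v (enum_rank x) 0).
  by rewrite [RHS](reindex_inj (inv_inj (@query_basisK W g))).
rewrite (sum_query_mass v (fun i => c i != h i)) normsq_index.
rewrite (bigID D) /= [X in _ + X]big1 => [|x]; last first.
  rewrite negbK => /eqP cx.
  by rewrite oracle_diffE /query_basis cx subrr nsq0.
rewrite addr0 (_ : 4 = 2 + 2 :> R); last lra.
rewrite mulrDl -{1}(queryD c) -(queryD h) !big_distrr -big_split /=.
apply: ler_sum => x _; rewrite oracle_diffE.
apply: le_trans (nsqD_le _ _ ltr01) _; rewrite invr1.
by rewrite nsqN; lra.
Qed.

Lemma oracle_step_le W c h (u v : 'cV[R[i]]_#|qbasis N W|) e : 0 < e ->
  normsq (oracle R W c *m u - oracle R W h *m v) <=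
  (1 + e) * normsq (u - v) +
  (1 + e^-1) * (4 * \sum_(i | c i != h i) query_mass v i).
Proof.
move=> e0.
have -> : oracle R W c *m u - oracle R W h *m v =
    oracle R W c *m (u - v) + (oracle R W c *m v - oracle R W h *m v).
  exact: mulmx_diff_split.
apply: le_trans (normsqD_le _ _ e0) _.
rewrite normsq_unitary ?oracle_unitary // lerD2l ler_wpM2l ?oracle_diff_le //.
by rewrite addr_ge0 // invr_ge0 ltW.
Qed.

Variables (A : qlearner R N).

Lemma state_normsq c t : normsq (qlearner_state A c t) = 1.
Proof.
elim: t => [|t IHt] /=; rewrite normsq_unitary ?ql_unitaryP ?normsq_ket //.
by rewrite normsq_unitary ?oracle_unitary.
Qed.

(* Squaring the triangle inequality with the weights 1 + 1/t and 1 + t on the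
   t-th step gives this bound without square roots. *)
Lemma state_diff_le c h t :
  normsq (qlearner_state A c t - qlearner_state A h t) <=
  4 * t%:R * \sum_(i | c i != h i)
    \sum_(s < t) query_mass (qlearner_state A h s) i.
Proof.
elim: t => [|t IHt].
  by rewrite /= subrr mulr0 mul0r /normsq big1 // => a _; rewrite mxE nsq0.
have -> : normsq (qlearner_state A c t.+1 - qlearner_state A h t.+1) =
    normsq (oracle R (ql_work A) c *m qlearner_state A c t -
            oracle R (ql_work A) h *m qlearner_state A h t).
  by rewrite -mulmxBr normsq_unitary ?ql_unitaryP.
under eq_bigr do rewrite big_ord_recr /=.
rewrite big_split /=.
have [t0|t0] := posnP t.
  subst t; apply: le_trans (oracle_diff_le c h _) _.
  rewrite [X in X + _]big1 ?add0r ?mulr1 // => i _; exact: big_ord0.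
have it0 : 0 < t%:R^-1 :> R by rewrite invr_gt0 ltr0n.
apply: le_trans (oracle_step_le _ _ _ _ it0) _; rewrite invrK.
have t10 : 0 <= 1 + t%:R^-1 :> R by rewrite addr_ge0 // ltW.
apply: le_trans (lerD (ler_wpM2l t10 IHt) (lexx _)) _.
(* The weights give equality: (1 + 1/t) * 4t = (1 + t) * 4. *)
rewrite -[t.+1%:R]natr1 le_eqVlt; apply/orP; left; apply/eqP.
have tn0 : t%:R != 0 :> R by rewrite pnatr_eq0 -lt0n.
set S := \sum_(i | _) \sum_(s < t) _; set Q := \sum_(i | _) query_mass _ _.
move: S Q => S Q.
by clear -tn0; field.
Qed.

Lemma sum_query_masses h t :
  \sum_i \sum_(s < t) query_mass (qlearner_state A h s) i = t%:R.
Proof.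
rewrite exchange_big /= -[t in RHS]card_ord -sum1_card natr_sum.
apply: eq_bigr => s _; rewrite (sum_query_mass _ xpredT) -(state_normsq h s).
by rewrite normsq_index.
Qed.

Definition output_prob c h t := normsq (ql_meas A c *m qlearner_state A h t).

Lemma output_probE c t :
  (2 / 3 <= qlearner_success A t c) = (2 / 3 <= output_prob c c t).
Proof.
have -> : qlearner_success A t c = (output_prob c c t)%:C%C.
  by rewrite rmorph_sum; apply: eq_bigr => a _; rewrite /= nsqE.
have -> : 2 / 3 = (2 / 3)%:C%C :> R[i].
  by rewrite rmorphM fmorphV !rmorph_nat.
by rewrite lecR.
Qed.

Lemma sum_output_prob h t : \sum_c output_prob c h t = 1.
Proof. by rewrite normsq_measure ?ql_measP // state_normsq. Qed.

Lemma output_prob_ge0 c h t : 0 <= output_prob c h t.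
Proof. exact: normsq_ge0. Qed.

(* The final states are at squared distance at least
   1/84 = (2/3 - (1 + 1/6) * 1/2) / (1 + 6), and 336 = 4 * 84. *)
Lemma output_prob_diff c h t :
  2 / 3 <= output_prob c c t -> output_prob c h t <= 1 / 2 ->
  1 <= 336 * t%:R * \sum_(i | c i != h i)
    \sum_(s < t) query_mass (qlearner_state A h s) i.
Proof.
move=> pc ph; set D := \sum_(i | _) _.
have sixth : 0 < 1 / 6 :> R by lra.
have := normsqD_le (ql_meas A c *m qlearner_state A h t)
  (ql_meas A c *m (qlearner_state A c t - qlearner_state A h t)) sixth.
rewrite -mulmxDr addrC subrK -!/(output_prob _ _ _).
have := le_trans (normsq_measure_le _ c (ql_measP A)) (state_diff_le c h t).
rewrite -/D => m1 m2.
have i6 : (1 / 6)^-1 = 6 :> R by rewrite invf_div divr1.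
rewrite i6 in m2; lra.
Qed.

End Hybrid.

Lemma fETD_le_queries (R : realType) N (C : {set concept N}) T
    (A : qlearner R N) : (0 < #|C|)%N -> qlearns C T A ->
  fETD R C <= 336 * T%:R ^+ 2.
Proof.
move=> /card_gt0P [c0 c0C] lA.
apply/bigmax_leP; split=> [|h _]; first by rewrite -natrX -natrM ler0n.
pose cstar := [arg max_(c > c0 in C) output_prob A c h T]%O.
have [csC csmax] : cstar \in C /\
    forall c, c \in C -> output_prob A c h T <= output_prob A cstar h T.
  by rewrite /cstar; case: arg_maxP.
pose w i : R := 336 * T%:R * \sum_(s < T) query_mass (qlearner_state A h s) i.
have w0 i : 0 <= w i.
  apply: mulr_ge0; first by rewrite -natrM ler0n.
  by apply: sumr_ge0 => s _; exact: query_mass_ge0.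
apply: ge_inf.
  by exists 0 => _ [d [v [[_ v0 _] ->]]]; exact: sumr_ge0.
exists cstar, w; split; last first.
  by rewrite -big_distrr /= sum_query_masses; ring.
split=> // c cC ccs; rewrite -big_distrr /=.
apply: output_prob_diff; first by rewrite -output_probE lA.
(* [cstar] is at least as likely an output as [c], so [c] has probability at most 1/2. *)
have := sum_output_prob A h T.
rewrite (bigD1 cstar) //= (bigD1 c) //=.
have : 0 <= \sum_(i | (i != cstar) && (i != c)) output_prob A i h T.
  by apply: sumr_ge0 => d _; exact: output_prob_ge0.
by have := csmax c cC; lra.
Qed.

(** * Comparison of the bounds *)

Section QueryBounds.
Variables (R : realType) (N : nat) (C : {set concept N}).
Hypothesis card_ge2 : (2 <= #|C|)%N.
Implicit Types mu nu : concept N -> R.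

(** A concept with more than half of the mass is cut to 1/2 and the rest, of mass [r], rescaled to
    1/2. As [r] is at least a tenth of the total [m], the factor [1 / (2 r)] is at most [5 / m]. *)
Lemma rescale_heavy mu : (forall c, 0 <= mu c) -> 0 < total C mu ->
  (forall c, c \in C -> mu c <= 9 / 10 * total C mu) ->
  exists2 nu, bounded_dist C nu & forall c, c \in C -> nu c <= 5 / total C mu * mu c.
Proof.
move=> mu0 m0 mu9; set m := total C mu in m0 mu9 *.
have [[c0 c0C c0m]|light] := pselect (exists2 c, c \in C & m / 2 < mu c).
  have mE : m = mu c0 + \sum_(c in C | c != c0) mu c by rewrite -bigD1.
  set r := \sum_(c in C | c != c0) mu c in mE.
  have r10 : m / 10 <= r by have := mu9 _ c0C; lra.
  have r0 : 0 < 2 * r by lra.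
  exists (fun c => if c == c0 then 1 / 2 else mu c / (2 * r)).
    split; first split=> [c _|].
    - by case: eqP => // _; rewrite divr_ge0 // ltW.
    - rewrite (bigD1 c0) //= eqxx.
      rewrite (eq_bigr (fun c => mu c / (2 * r))) => [|c /andP[_ /negbTE ->] //].
      by rewrite -big_distrl /= -/r; field; lra.
    - move=> c cC; case: ifP => // /negbT cc0; rewrite ler_pdivrMr //.
      have : mu c <= r by rewrite /r (bigD1 c) /= ?cC // lerDl sumr_ge0.
      lra.
  move=> c cC; case: ifP => [/eqP ->|_].
    by rewrite mulrAC ler_pdivlMr //; lra.
  rewrite mulrC ler_wpM2r // -[leRHS]invf_div lef_pV2 ?posrE ?divr_gt0 //; lra.
exists (fun c => mu c / m).
  split; first split=> [c _|]; first by rewrite divr_ge0 // ltW.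
    by rewrite -big_distrl /= divff // gt_eqF.
  move=> c cC; rewrite ler_pdivrMr // leNgt; apply/negP => cm; apply: light.
  by exists c => //; lra.
by move=> c _; rewrite mulrC ler_wpM2r // ler_peMl ?invr_ge0 ?(ltW m0) //; lra.
Qed.

Let g := fgamma R C.

Let g_gt0 : 0 < g. Proof. exact: fgamma_gt0. Qed.

Let g_le_half : g <= 1 / 2. Proof. exact: fgamma_le_half. Qed.

Lemma heavy_splitting mu : (forall c, 0 <= mu c) -> 0 < total C mu ->
  (forall c, c \in C -> mu c <= 9 / 10 * total C mu) ->
  exists i, forall b, g / 5 * total C mu <= \sum_(c in C | c i == b) mu c.
Proof.
move=> mu0 m0 mu9; have [nu Bnu numu] := rescale_heavy mu0 m0 mu9.
have [i gi] := splitting_index card_ge2 Bnu; exists i => b.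
have : g <= 5 / total C mu * \sum_(c in C | c i == b) mu c.
  apply: le_trans (gi b) _; rewrite big_distrr /=.
  by apply: ler_sum => c /andP[cC _]; exact: numu.
by rewrite mulrAC ler_pdivlMr //; lra.
Qed.

Let gain := g * ln (1 / g + 1).

Let inv_g_ge2 : 2 <= 1 / g.
Proof. by rewrite ler_pdivlMr //; have := g_le_half; lra. Qed.

Let gain_gt0 : 0 < gain.
Proof. by rewrite mulr_gt0 // ln_gt0 //; have := inv_g_ge2; lra. Qed.

Let gain_le1 : gain <= 1.
Proof.
have : ln (1 + 1 / g) <= 1 / g by apply: le_ln1Dx; have := inv_g_ge2; lra.
by rewrite addrC -(ler_pM2l g_gt0) mulrCA divff ?mulr1 // gt_eqF.
Qed.

(** About [200 ln |C| / gain] queries suffice; 400 absorbs the rounding, since [ln |C| >= 1/2] and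
    [gain <= 1]. *)
Lemma RQ_le_gain : (RQ R C)%:R <= 400 * (ln #|C|%:R / gain) :> R.
Proof.
have lnC : 1 / 2 <= ln #|C|%:R :> R.
  apply: le_trans (ln2_ge_half R) _.
  by rewrite ler_ln ?posrE ?ltr0n ?ler_nat // ltnW.
have [gg0 gg1 ig2] := And3 gain_gt0 gain_le1 inv_g_ge2.
have q1 : 1 / 2 <= ln #|C|%:R / gain.
  by rewrite ler_pdivlMr //; lra.
pose x := 200 * (ln #|C|%:R / gain); pose T := (Num.truncn x).+1.
have /andP[Tx xT] : (T%:R <= x + 1) && (x < T%:R).
  have x0 : 0 <= x by rewrite /x; lra.
  by have /andP[? ?] := truncn_itv x0; rewrite /T -natr1 lerD2r natr1; apply/andP.
suff [A lA] : exists A : rlearner R N, rlearns C T A.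
  have := (RQP R C).2 T A lA; rewrite -(ler_nat R) => /le_trans; apply.
  by apply: le_trans Tx _; rewrite /x; lra.
apply: worst_case_learner => mu mu0.
have r01 : 0 < g / 5 <= 1.
  by have [? ?] := conj g_gt0 g_le_half; apply/andP; split; lra.
apply: (bayes_tree_success r01 heavy_splitting) => //.
(* Since [1 / g >= 2], [5 / g] exceeds [1 / g + 1]. *)
have g5 : ln (1 / g + 1) <= ln (g / 5)^-1.
  rewrite invf_div ler_ln ?posrE ?divr_gt0 //; last lra.
  have -> : 5 / g = 5 * (1 / g) by rewrite mulrA mulr1.
  lra.
(* The 1/20 is the 1/4 of [xlnx_split] times the 1/5 of [heavy_splitting]; 200 = 10 * 20. *)
apply: (@le_trans _ _ (T%:R * (1 / 20 * gain))); last first.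
  rewrite ler_wpM2l // /gain; have := ler_wpM2l (ltW g_gt0) g5; lra.
have := xT; rewrite /x mulrA ltr_pdivrMr //; lra.
Qed.

Lemma RQ_le_fgamma : (RQ R C)%:R <=
  400 * (1 / (g * log2 (1 / g + 1))) * log2 #|C|%:R.
Proof.
have l20 : 0 < ln 2 :> R by have := ln2_ge_half R; lra.
have l0 : 0 < ln (1 / g + 1) by apply: ln_gt0; have := inv_g_ge2; lra.
apply: le_trans RQ_le_gain _; rewrite /log2 /gain le_eqVlt; apply/orP; left.
by apply/eqP; field; rewrite !gt_eqF.
Qed.

(** [ln_ratio_monotone] is applied to [1 / g <= 2 F]; lowering [ln (2 F + 1)] to [ln (F + 1)] leaves
    the factor 2 that turns 400 into 800. *)
Lemma RQ_le_fETD : (RQ R C)%:R <=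
  800 * (fETD R C / log2 (fETD R C + 1)) * log2 #|C|%:R.
Proof.
have l20 : 0 < ln 2 :> R by have := ln2_ge_half R; lra.
have gF : 1 / g <= 2 * fETD R C := inv_fgamma_le R card_ge2.
set F := fETD R C in gF *.
have ig2 := inv_g_ge2; have F0 : 0 < F by lra.
have g0 : 0 < 1 / g by lra.
have l0 : 0 < ln (1 / g + 1) by apply: ln_gt0; have := inv_g_ge2; lra.
have l1 : 0 < ln (F + 1) by apply: ln_gt0; lra.
have lC : 0 <= ln #|C|%:R :> R by rewrite ln_ge0 // ler1n ltnW.
have H : gain^-1 <= 2 * (F / ln (F + 1)).
  have -> : gain^-1 = 1 / g / ln (1 / g + 1) by rewrite /gain invfM div1r.
  apply: le_trans (ln_ratio_monotone g0 gF) _; rewrite mulrA.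
  rewrite ler_wpM2l ?lef_pV2 ?posrE ?ler_ln ?posrE //; try lra.
  by apply: ln_gt0; lra.
apply: le_trans RQ_le_gain _.
apply: (@le_trans _ _ (400 * (ln #|C|%:R * (2 * (F / ln (F + 1)))))).
  by have := ler_wpM2l lC H; lra.
rewrite /log2 le_eqVlt; apply/orP; left.
by apply/eqP; field; rewrite !gt_eqF.
Qed.

(** The constant 26 serves both forms: 26^2 = 676 exceeds 2 * 336 = 672. *)
Lemma sqrt_le_queries (x : R) (n : nat) :
  x <= (26 * n%:R) ^+ 2 -> 1 / 26 * Num.sqrt x <= n%:R.
Proof.
have n0 : 0 <= 26 * n%:R :> R by rewrite -natrM ler0n.
move=> /ler_wsqrtr; rewrite sqrtr_sqr ger0_norm // => sx.
by rewrite mulrAC mul1r ler_pdivrMr ?ltr0n // [leRHS]mulrC.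
Qed.

Hypothesis N_gt0 : (0 < N)%N.

Lemma fETD_le_QQ : fETD R C <= 336 * (QQ R C)%:R ^+ 2.
Proof.
have [A lA] := (QQP R C N_gt0).1.
by apply: fETD_le_queries lA; exact: leq_trans card_ge2.
Qed.

Lemma QQ_ge_fETD : 1 / 26 * Num.sqrt (fETD R C) <= (QQ R C)%:R.
Proof.
apply: sqrt_le_queries; rewrite exprMn; have := fETD_le_QQ.
have : 0 <= (QQ R C)%:R ^+ 2 :> R by rewrite exprn_ge0.
lra.
Qed.

Lemma QQ_ge_fgamma : 1 / 26 * Num.sqrt (1 / g) <= (QQ R C)%:R.
Proof.
apply: sqrt_le_queries; rewrite exprMn; have := fETD_le_QQ.
have gF : 1 / g <= 2 * fETD R C := inv_fgamma_le R card_ge2.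
have : 0 <= (QQ R C)%:R ^+ 2 :> R by rewrite exprn_ge0.
lra.
Qed.

End QueryBounds.

Theorem theorem1p6 (R : realType) :
  (exists kappa K : R, [/\ 0 < kappa, 0 < K &
     forall (N : nat) (C : {set concept N}), (1 <= N)%N -> (2 <= #|C|)%N ->
       kappa * Num.sqrt (fETD R C) <= (QQ R C)%:R /\
       (RQ R C)%:R <=
         K * (fETD R C / log2 (fETD R C + 1)) * log2 (#|C|%:R)])
  /\
  (exists kappa K : R, [/\ 0 < kappa, 0 < K &
     forall (N : nat) (C : {set concept N}), (1 <= N)%N -> (2 <= #|C|)%N ->
       kappa * Num.sqrt (1 / fgamma R C) <= (QQ R C)%:R /\
       (RQ R C)%:R <=
         K * (1 / (fgamma R C * log2 (1 / fgamma R C + 1))) * log2 (#|C|%:R)]).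
Proof.
split; [exists (1 / 26), 800|exists (1 / 26), 400];
  (split; [by rewrite divr_gt0 // ltr0n | by rewrite ltr0n |]) => N C N0 C2.
- by split; [exact: QQ_ge_fETD | exact: RQ_le_fETD].
- by split; [exact: QQ_ge_fgamma | exact: RQ_le_fgamma].
Qed.
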